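(* Let $q$ be a prime power, $n\in\mathbb{N}$, $m=\lfloor n/2\rfloor$, and let $i,j,t\in\{0,\ldots,n\}$. Write $$\Phi(M^t_{i,j})=(N_0,\ldots,N_m),$$ where, for $k=0,\ldots,m$, the rows and columns of $N_k$ are indexed by $\{k,k+1,\ldots,n-k\}$. Then, for $0\le k\le m$, $$N_k=\begin{cases} q^{\frac{k(i+j)}{2}}\,\binom{n-2k}{i-k}_q^{-\frac12}\,\binom{n-2k}{j-k}_q^{-\frac12}\,\beta^{n,t}_{i,j,k}(q)\,E_{i,j,k} & \text{if } k\le i,j\le n-k,\\ 0 & \text{otherwise.}\end{cases}$$
   Context: Notation. $\binom{a}{b}_q$ is the $q$-binomial coefficient (the number of $b$-dimensional subspaces of an $a$-dimensional space over $\mathbb{F}_q$), taken to be $0$ when $b<0$ or $b>a$. $B_q(n)$ is the set of all subspaces of an $n$-dimensional vector space over $\mathbb{F}_q$, and $B_q(n)_i$ is the set of $i$-dimensional ones. $V(B_q(n))$ is the complex vector space with basis $B_q(n)$, with the standard inner product making $B_q(n)$ orthonormal, and norm $\|\cdot\|$. The group $G=GL(n,\mathbb{F}_q)$ acts on $B_q(n)$ and hence on $V(B_q(n))$. For $f\in\mathrm{End}(V(B_q(n)))$, $M_f$ denotes its $B_q(n)\times B_q(n)$ matrix in the standard basis (elements of $V(B_q(n))$ are column vectors), and $M(X,Y)$ denotes the entry of $M$ in row $X$, column $Y$. Let $\mathcal{A}(q,n)=\{M_f: f\in \mathrm{End}_G(V(B_q(n)))\}$. For $0\le i,j,t\le n$,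 $M^t_{i,j}\in\mathcal{A}(q,n)$ is the $B_q(n)\times B_q(n)$ matrix with $M^t_{i,j}(X,Y)=1$ if $\dim X=i$, $\dim Y=j$, $\dim(X\cap Y)=t$, and $M^t_{i,j}(X,Y)=0$ otherwise. Symmetric Jordan bases. The up operator $U$ on $V(B_q(n))$ is the linear map with $U(X)=\sum_Y Y$, the sum over all $Y\supseteq X$ with $\dim Y=\dim X+1$. A symmetric Jordan chain is a sequence $(v_k,\ldots,v_{n-k})$, $k\le n/2$, of nonzero vectors with $v_i\in V(B_q(n)_i)$ for all $i$, $U(v_{i-1})=v_i$ for $k+1\le i\le n-k$, and $U(v_{n-k})=0$; it starts at rank $k$ and ends at rank $n-k$. A symmetric Jordan basis is a basis of $V(B_q(n))$ that is a disjoint union of symmetric Jordan chains. Fix a symmetric Jordan basis $J(q,n)$ of $V(B_q(n))$ whose elements are pairwise orthogonal and such that for every chain $(v_k,\ldots,v_{n-k})$ in it and $k\le u<n-k$ one has $\|v_{u+1}\|/\|v_u\|=\sqrt{q^k[u+1-k]_q[n-k-u]_q}$, where $[a]_q=1+q+\cdots+q^{a-1}$ (such a basis exists). Let $J'(q,n)$ be the orthonormal basis obtained by normalizing the vectors of $J(q,n)$, and let $N(n)$ be the unitary $B_q(n)\times J'(q,n)$ matrix whose column indexed by $v\in J'(q,n)$ is the coordinate vector of $v$ in the standard basis. The map $\Phi$. Put $p_k=n-2k+1$ and $q_k=\binom{n}{k}_q-\binom{n}{k-1}_q$ for $k=0,\ldots,m$. The set $N(n)^*\mathcal{A}(q,n)N(n)$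 consists of all $J'(q,n)\times J'(q,n)$ block diagonal matrices with one block for each (normalized) symmetric Jordan chain in $J(q,n)$, where any two chains starting (and ending) at the same rank give identical blocks; so there are $q_k$ identical blocks of size $p_k$ for $k=0,\ldots,m$. The rows and columns of a block corresponding to a chain starting at rank $k$ are indexed by $\{k,k+1,\ldots,n-k\}$ (index $i$ corresponding to the normalized vector of rank $i$ in the chain). The map $$\Phi:\mathcal{A}(q,n)\cong\bigoplus_{k=0}^m \mathrm{Mat}(p_k\times p_k)$$ (complex matrices) is defined by conjugation $M\mapsto N(n)^*MN(n)$ followed by dropping duplicate blocks, so that its $k$-th component is the common block of the chains starting at rank $k$. Other notation. For $i,j,k,t\in\{0,\ldots,n\}$, $$\beta^{n,t}_{i,j,k}(q)=\sum_{u=0}^n(-1)^{u-t}\,q^{\binom{u-t}{2}-ku}\,\binom{u}{t}_q\binom{n-2k}{u-k}_q\binom{n-k-u}{i-u}_q\binom{n-k-u}{j-u}_q,$$ where $\binom{u-t}{2}$ in the exponent is the ordinary binomial coefficient. For $0\le k\le m$ and $k\le i,j\le n-k$, $E_{i,j,k}$ is the $p_k\times p_k$ matrix with rows and columns indexed by $\{k,k+1,\ldots,n-k\}$ having entry $1$ in row $i$, column $j$, and $0$ elsewhere. *)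

(* Defs.v *)
From HB Require Import structures.
From mathcomp Require Import all_boot all_order all_algebra.
From mathcomp Require Import boolp classical_sets.

Set Implicit Arguments.
Unset Strict Implicit.
Unset Printing Implicit Defensive.

Import GRing.Theory Num.Theory.
Local Open Scope ring_scope.

Section FiniteSubspaces.
Import VectorInternalTheory.
Variables (F : finFieldType) (vT : vectType F).

HB.instance Definition _ := [Countable of {vspace vT} by <:].
HB.instance Definition _ := [Finite of {vspace vT} by <:].

End FiniteSubspaces.

(* Matrices with rows and columns indexed by finite types are ordinary matrices,
   the indices being transported along [enum_rank]. *)
Notation idxmx C I J := 'M[C]_(#|{: I}|, #|{: J}|).

Definition entry (C : Type) (I J : finType) (M : idxmx C I J) (x : I) (y : J) : C :=
  M (enum_rank x) (enum_rank y).

Definition mx_of (C : Type) (I J : finType) (f : I -> J -> C) : idxmx C I J :=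
  \matrix_(a, b) f (enum_val a) (enum_val b).

Definition adjmx (C : numClosedFieldType) (a b : nat) (M : 'M[C]_(a, b)) :
  'M[C]_(b, a) := map_mx Num.conj M^T.

Notation Bq F n := {vspace 'cV[F]_n}.
Notation VB C F n := 'cV[C]_#|{: Bq F n}|.

(* The integer arguments allow the convention that the coefficient is 0 outside
   0 <= b <= a; truncated subtraction on [nat] would break it. *)
Definition qbinom (F : finFieldType) (a b : int) : nat :=
  match a, b with
  | Posz a', Posz b' => #|[set X : Bq F a' | \dim X == b']|
  | _, _ => 0
  end.

Definition qint (q a : nat) : nat := (\sum_(s < a) q ^ s)%N.

Section Algebra.
Variables (C : numClosedFieldType) (F : finFieldType) (n : nat).
Implicit Types (g : 'End('cV[F]_n)) (X Y : Bq F n) (v w : VB C F n).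

Definition GLact g : idxmx C (Bq F n) (Bq F n) :=
  mx_of (fun Y X => (Y == (g @: X)%VS)%:R).

(* [lker g == 0] says that the endomorphism g of F^n lies in GL(n, F). *)
Definition GL_equivariant (M : idxmx C (Bq F n) (Bq F n)) : Prop :=
  forall g, lker g == 0%VS -> M *m GLact g = GLact g *m M.

Definition Aqn := {M : idxmx C (Bq F n) (Bq F n) | GL_equivariant M}.

Definition Mt_mx (i j t : nat) : idxmx C (Bq F n) (Bq F n) :=
  mx_of (fun X Y => [&& \dim X == i, \dim Y == j & \dim (X :&: Y) == t]%:R).

Lemma Mt_equivariant i j t : GL_equivariant (Mt_mx i j t).
Proof.
move=> g g0; apply/matrixP => a b; rewrite !mxE.
have dimg X : \dim (g @: X) = \dim X.
  by rewrite limg_dim_eq // (eqP g0) capv0.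
have gK X : (g @: (g^-1 @: X))%VS = X.
  by rewrite -limg_comp lker0_compfV // lim1g.
have ginj X Y : (g @: X)%VS = (g @: Y)%VS -> X = Y.
  by move=> eqXY; apply/eqP; rewrite -(eq_limg_ker0 _ _ g0) eqXY.
rewrite (bigD1 (enum_rank (g @: enum_val b)%VS)) //= big1 ?addr0; last first.
  move=> c ne_c; rewrite [GLact g c b]mxE; case: eqP => [eq_c|_]; last exact: mulr0.
  by rewrite -eq_c enum_valK eqxx in ne_c.
rewrite (bigD1 (enum_rank (g^-1 @: enum_val a)%VS)) //= big1 ?addr0; last first.
  move=> c ne_c; rewrite mxE; case: eqP => [eq_c|_]; last exact: mul0r.
  case/eqP: ne_c; rewrite -[LHS]enum_valK; congr enum_rank; apply: ginj.
  by rewrite gK.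
rewrite !mxE !enum_rankK gK !eqxx mulr1 mul1r -{1 2}[enum_val a]gK !dimg.
by rewrite -lker0_img_cap // dimg.
Qed.

Definition Mt i j t : Aqn := exist _ _ (Mt_equivariant i j t).

Definition cvdot v w : C := (adjmx v *m w) 0 0.
Definition cvnorm v : C := sqrtC (cvdot v v).

Definition upmx : idxmx C (Bq F n) (Bq F n) :=
  mx_of (fun Y X => ((X <= Y)%VS && (\dim Y == (\dim X).+1))%:R).

Definition homogeneous (i : nat) v : Prop :=
  forall X, \dim X != i -> v (enum_rank X) 0 = 0.

(* The chain is (v k, ..., v (n - k)); the other values of v are irrelevant. *)
Definition symmetric_Jordan_chain (k : nat) (v : nat -> VB C F n) : Prop :=
  [/\ (k.*2 <= n)%N,
      forall i, (k <= i <= n - k)%N -> v i != 0 /\ homogeneous i (v i),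
      forall i, (k < i <= n - k)%N -> upmx *m v i.-1 = v i
    & upmx *m v (n - k)%N = 0].

Definition blocksize (k : nat) : nat := (n - k.*2).+1.

(* [chain k] is the set of the chains that start at rank k, and [cvec c u] is
   the vector of rank u of the chain c. *)
Record chain_family := ChainFamily {
  chain : 'I_n./2.+1 -> finType;
  cvec : forall k, chain k -> nat -> VB C F n
}.

Section Family.
Variable J : chain_family.

(* The triple (k, c, a) indexes the vector of rank k + a of the chain c. *)
Definition jindex := {k : 'I_n./2.+1 & (chain J k * 'I_(blocksize k))%type}.

Definition jidx k (c : chain J k) (a : 'I_(blocksize k)) : jindex :=
  Tagged (fun k => (chain J k * 'I_(blocksize k))%type) (c, a).

Definition jchain (x : jindex) : {k : 'I_n./2.+1 & chain J k} :=
  Tagged (fun k => Finite.sort (chain J k)) (tagged x).1.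

Definition jvec (x : jindex) : VB C F n :=
  cvec (tagged x).1 (tag x + (tagged x).2)%N.

Definition symmetric_Jordan_basis : Prop :=
  (forall k (c : chain J k), symmetric_Jordan_chain k (cvec c)) /\
  basis_of fullv [seq jvec x | x : jindex].

Definition orthogonal_basis : Prop :=
  forall x y : jindex, x != y -> cvdot (jvec x) (jvec y) = 0.

Definition norm_ratios : Prop :=
  forall k (c : chain J k) (u : nat), (k <= u < n - k)%N ->
  cvnorm (cvec c u.+1) / cvnorm (cvec c u) =
  sqrtC (#|F| ^ k * qint #|F| (u.+1 - k) * qint #|F| (n - k - u))%N%:R.

Definition Nmx : idxmx C (Bq F n) jindex :=
  mx_of (fun X x => (cvnorm (jvec x))^-1 * jvec x (enum_rank X) 0).

Definition block_family := {dffun forall k : 'I_n./2.+1, 'M[C]_(blocksize k)}.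

(* D is block diagonal, the block of every chain starting at rank k being P k. *)
Definition has_blocks (D : idxmx C jindex jindex) (P : block_family) : Prop :=
  (forall x y : jindex, jchain x != jchain y -> entry D x y = 0) /\
  (forall k (c : chain J k) a b, entry D (jidx c a) (jidx c b) = P k a b).

(* Some chain starts at each rank k (their number is q_k > 0), so that has_blocks
   determines P; the default 0 only makes the definition total. *)
Definition Phi (M : Aqn) : block_family :=
  xget ([ffun k : 'I_n./2.+1 => 0 : 'M[C]_(blocksize k)] : block_family)
    [set P | has_blocks (adjmx Nmx *m sval M *m Nmx) P].

End Family.

(* The exponent binomial is that of truncated u - t: for u < t the term vanishes
   because of the factor qbinom u t. *)
Definition beta (t i j k : nat) : C :=
  \sum_(u < n.+1)
    (-1) ^ (u%:Z - t%:Z) * #|F|%:R ^ ('C(u - t, 2)%:Z - (k * u)%:Z)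
    * (qbinom F u t)%:R
    * (qbinom F (n%:Z - (k.*2)%:Z) (u%:Z - k%:Z))%:R
    * (qbinom F (n%:Z - k%:Z - u%:Z) (i%:Z - u%:Z))%:R
    * (qbinom F (n%:Z - k%:Z - u%:Z) (j%:Z - u%:Z))%:R.

(* Row a and column b of the matrix carry the labels k + a and k + b. *)
Definition Emx (i j k : nat) : 'M[C]_(blocksize k) :=
  \matrix_(a, b) ((k + a == i) && (k + b == j))%N%:R.

End Algebra.

(* Main.v *)
Require Import Defs.
From mathcomp Require Import all_boot all_order all_algebra finfield.
From mathcomp Require Import zify ring.
From mathcomp Require Import boolp reals complex.

(** Write [incl i u] for the matrix of the relation: X has dimension i, Y has
    dimension u and Y is contained in X. Two facts determine the blocks of
    M^t_(i,j).

    - Moebius inversion over the subspaces of X :&: Y gives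
        M^t_(i,j) = \sum_u (-1)^(u-t) q^C(u-t,2) [u choose t]_q
                            (incl i u) (incl j u)^*
      because the (X, Y) entry of (incl i u) (incl j u)^* counts the
      u-dimensional subspaces of X :&: Y ([moebius_inversion], [Mt_moebius]).

    - On vectors of rank u, [incl i u] is the divided power
      U^(i-u) / [i-u]_q! of the up operator, because there are [d]_q
      hyperplanes between subspaces at distance d ([upmx_incl]). It therefore
      sends the vector v_u of a symmetric Jordan chain to v_i / [i-u]_q!, or to
      0 when the chain stops before rank i ([incl_chain]). In the orthonormal
      basis, [incl i u] thus has the single entry |v_i| / (|v_u| [i-u]_q!) in
      each chain that reaches both ranks, and 0 elsewhere ([entry_incl]).

    The basis matrix N is unitary, so N^* M^t_(i,j) N is the same alternating
    sum of products of these sparse matrices; it is block diagonal with one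
    possibly nonzero entry per block ([entry_Mt], [sum_incl_coef]). The
    prescribed norm ratios multiply up to
      |v_(k+a)| = |v_k| q^(ka/2) [a]_q! [n-2k choose a]_q^(1/2)
    ([chain_norm]), which turns |v_i| / (|v_u| [i-u]_q!) into
      q^(k(i-u)/2) [n-2k choose u-k]_q^(1/2) [n-2k choose i-k]_q^(-1/2)
                   [n-k-u choose i-u]_q
    ([norm_quotient]); the product of two such factors, one for i and one for j,
    is a term of beta ([entry_Mt_diag]).

    The blocks pin down the value of Phi at rank k only if some chain starts
    there. The number of basis vectors of rank r is the trace of the projection
    [incl r r], that is [n choose r]_q. If no chain started at rank k, every
    chain through rank k would pass through rank k - 1, against
    [n choose k-1]_q < [n choose k]_q for 2k <= n ([chain_exists]). *)

Set Implicit Arguments.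
Unset Strict Implicit.
Unset Printing Implicit Defensive.

Import Order.TTheory GRing.Theory Num.Theory.
Local Open Scope ring_scope.

(* The match on the integer arguments must not be exposed by simplification. *)
Arguments qbinom : simpl never.

(** * Counting subspaces of a finite vector space *)

Section Counting.
Variables (F : finFieldType) (n : nat).
Implicit Types (W X Y Z : Bq F n).
Local Notation q := #|F|.
Local Open Scope nat_scope.

Lemma card_subspace X : #|[set v : 'cV[F]_n | v \in X]| = q ^ \dim X.
Proof. by rewrite -card_vspace; apply: eq_card => v; rewrite inE. Qed.

Lemma q_gt1 : 1 < q.
Proof. exact: finNzRing_gt1. Qed.

Lemma qint_pred a : (q - 1) * qint q a = q ^ a - 1.
Proof.
rewrite /qint; elim: a => [|a IHa]; first by rewrite big_ord0 muln0.
rewrite big_ord_recr /= mulnDr IHa expnS mulnBl mul1n.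
have : 0 < q ^ a by rewrite expn_gt0 (ltnW q_gt1).
have : q ^ a <= q * q ^ a by rewrite leq_pmull // (ltnW q_gt1).
by move: (q ^ a) (q * q ^ a) => r s; lia.
Qed.

Lemma qint_gt0 a : 0 < qint q a.+1.
Proof. by rewrite /qint big_ord_recl expn0. Qed.

Definition covers_between Y X :=
  [set Z : Bq F n | [&& (Y <= Z)%VS, (Z <= X)%VS & \dim Z == (\dim Y).+1]].

Definition cocovers_between Y X :=
  [set Z : Bq F n | [&& (Y <= Z)%VS, (Z <= X)%VS & (\dim Z).+1 == \dim X]].

Lemma dim_addv_line Y (v : 'cV[F]_n) : v \notin Y ->
  \dim (Y + <[v]>) = (\dim Y).+1.
Proof.
move=> Yv; rewrite dimv_disjoint_sum ?dim_vline.
  by case: eqP Yv => [-> | _]; rewrite ?mem0v // addn1.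
apply/eqP; rewrite -subv0; apply/subvP=> w; rewrite memv_cap => /andP[Yw].
case/vlineP=> a def_w; move: Yw; rewrite def_w.
have [-> | a0] := eqVneq a 0%R; first by rewrite scale0r !mem0v.
by rewrite rpredZeq (negPf a0) (negPf Yv).
Qed.

Lemma addv_line_eq Y Z (v : 'cV[F]_n) : (Y <= Z)%VS -> \dim Z = (\dim Y).+1 ->
  (v \notin Y) && ((Y + <[v]>)%VS == Z) = (v \in Z) && (v \notin Y).
Proof.
move=> leYZ dimZ; case Yv: (v \in Y); rewrite ?andbF ?andbT //=.
apply/eqP/idP=> [<- | Zv]; first by rewrite (subvP (addvSr Y _)) // memv_line.
apply/eqP; rewrite eqEdim subv_add leYZ -memvE Zv /=.
by rewrite dimZ dim_addv_line ?Yv.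
Qed.

Lemma card_subspaceD Y X : (Y <= X)%VS ->
  #|[set v : 'cV[F]_n | (v \in X) && (v \notin Y)]| = q ^ \dim X - q ^ \dim Y.
Proof.
move=> leYX; rewrite -!card_subspace -cardsDS.
  by apply: eq_card => v; rewrite !inE andbC.
by apply/subsetP=> v; rewrite !inE; apply: (subvP leYX).
Qed.

(** The vectors of X outside Y are partitioned by the cover Y + <[v]> that they
    span together with Y, and each part has q^(dim Y + 1) - q^(dim Y) elements. *)
Lemma card_covers Y X : (Y <= X)%VS ->
  #|covers_between Y X| = qint q (\dim X - \dim Y).
Proof.
move=> leYX; have le_dim := dimvS leYX.
have := card_subspaceD leYX; rewrite -sum1dep_card.
rewrite (partition_big (fun v => (Y + <[v]>)%VS) (mem (covers_between Y X))) /=;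
  last first.
  move=> v /andP[Xv Yv]; rewrite inE addvSl subv_add leYX -memvE Xv /=.
  by rewrite dim_addv_line.
rewrite (eq_bigr (fun=> q ^ (\dim Y).+1 - q ^ \dim Y)); last first.
  move=> Z; rewrite inE => /and3P[leYZ leZX /eqP dimZ].
  rewrite -dimZ -card_subspaceD // -sum1dep_card; apply: eq_bigl => v.
  rewrite -andbA addv_line_eq // andbA; apply: andb_id2r => _.
  by case Zv: (v \in Z); rewrite ?andbF ?(subvP leZX).
have -> : q ^ \dim X - q ^ \dim Y = (q - 1) * qint q (\dim X - \dim Y) * q ^ \dim Y.
  by rewrite qint_pred mulnBl mul1n -expnD subnK.
have -> : q ^ (\dim Y).+1 - q ^ \dim Y = (q - 1) * q ^ \dim Y.
  by rewrite mulnBl mul1n -expnS.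
rewrite sum_nat_const.
have q0 : 0 < q ^ \dim Y by rewrite expn_gt0 (ltnW q_gt1).
have q1 : 0 < q - 1 by rewrite subn_gt0 q_gt1.
by rewrite mulnA => /eqP; rewrite eqn_pmul2r // mulnC eqn_pmul2l // => /eqP.
Qed.

(** Induction on the distance d between Y and X, which avoids duality: for
    d >= 2, count the pairs A <= Z where A covers Y and X covers Z. Choosing A
    first gives [d] [d-1] by induction, choosing Z first gives [d-1] for each
    hyperplane Z. *)
Lemma card_cocovers Y X : (Y <= X)%VS ->
  #|cocovers_between Y X| = qint q (\dim X - \dim Y).
Proof.
move=> leYX; have le_dim := dimvS leYX.
move def_d: (\dim X - \dim Y) => d.
elim: d => [|[|d] IHd] in Y leYX le_dim def_d *.
- rewrite /qint big_ord0; apply/eqP; rewrite cards_eq0 -subset0.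
  apply/subsetP=> Z; rewrite inE => /and3P[/dimvS le_YZ _ /eqP dimZ].
  by move: def_d; lia.
- rewrite /qint big_ord1 expn0; transitivity #|[set Y]|; last exact: cards1.
  apply: eq_card => Z; rewrite !inE.
  apply/and3P/eqP=> [[leYZ _ /eqP dimZ] | ->]; last first.
    by rewrite subvv leYX; split=> //; lia.
  by apply/eqP; rewrite eq_sym eqEdim leYZ; move: def_d; lia.
have dbl : \sum_(A in covers_between Y X) #|cocovers_between A X| =
    \sum_(Z in cocovers_between Y X) #|covers_between Y Z|.
  under eq_bigr do rewrite -sum1_card; under [RHS]eq_bigr do rewrite -sum1_card.
  rewrite (exchange_big_dep (mem (cocovers_between Y X))) /=.
    apply: eq_bigr => Z; rewrite inE => /and3P[leYZ leZX dimZ].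
    apply: eq_bigl => A; rewrite !inE leZX dimZ andbT -!andbA.
    case: (A <= Z)%VS / boolP => [leAZ|]; last by rewrite !andbF.
    by rewrite (subv_trans leAZ leZX) /= andbT.
  move=> A Z; rewrite !inE => /and3P[leYA _ _] /and3P[leAZ -> ->].
  by rewrite (subv_trans leYA leAZ).
move: dbl; rewrite (eq_bigr (fun=> qint q d.+1)); last first.
  move=> A; rewrite inE => /and3P[leYA leAX /eqP dimA].
  by apply: IHd; rewrite ?(dimvS leAX) //; move: def_d; lia.
rewrite [RHS](eq_bigr (fun=> qint q d.+1)); last first.
  move=> Z; rewrite inE => /and3P[leYZ leZX /eqP dimZ].
  by rewrite card_covers //; congr qint; move: def_d; lia.
rewrite !sum_nat_const card_covers // def_d => /eqP.
by rewrite eqn_pmul2r ?qint_gt0 // => /eqP.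
Qed.

Definition subspaces_in W (b : nat) := [set Z : Bq F n | (Z <= W)%VS && (\dim Z == b)].

(** Both sides count the pairs A <= Z of subspaces of W of dimensions b and
    b + 1. *)
Lemma card_subspaces_rec W b :
  #|subspaces_in W b| * qint q (\dim W - b) = #|subspaces_in W b.+1| * qint q b.+1.
Proof.
transitivity (\sum_(A in subspaces_in W b) #|covers_between A W|).
  rewrite (eq_bigr (fun=> qint q (\dim W - b))) ?sum_nat_const // => A.
  by rewrite inE => /andP[leAW /eqP <-]; rewrite card_covers.
transitivity (\sum_(Z in subspaces_in W b.+1) #|cocovers_between 0 Z|).
  under eq_bigr do rewrite -sum1_card; under [RHS]eq_bigr do rewrite -sum1_card.
  rewrite (exchange_big_dep (mem (subspaces_in W b.+1))) /=.
    apply: eq_bigr => Z; rewrite inE => /andP[leZW /eqP dimZ].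
    apply: eq_bigl => A; rewrite !inE leZW sub0v dimZ eqSS /=.
    case: eqP => [->|_]; rewrite ?andbF // !andbT eqxx andbT andbC.
    by case leAZ: (A <= Z)%VS; rewrite // (subv_trans leAZ leZW).
  by move=> A Z; rewrite !inE => /andP[_ /eqP <-] /and3P[_ ->].
rewrite (eq_bigr (fun=> qint q b.+1)) ?sum_nat_const // => Z.
by rewrite inE => /andP[_ /eqP <-]; rewrite card_cocovers ?sub0v // dimv0 subn0.
Qed.

Lemma card_subspaces0 W : #|subspaces_in W 0| = 1.
Proof.
transitivity #|[set (0%VS : Bq F n)]|; last exact: cards1.
apply: eq_card => Z; rewrite !inE dimv_eq0.
by case: eqP => [->|_]; rewrite ?sub0v ?andbF.
Qed.

Lemma card_subspaces_gt W b : \dim W < b -> #|subspaces_in W b| = 0.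
Proof.
move=> lt_b; apply/eqP; rewrite cards_eq0 -subset0; apply/subsetP=> Z.
by rewrite inE => /andP[/dimvS le_dim /eqP dimZ]; lia.
Qed.

End Counting.

Section QBinomial.
Variable F : finFieldType.
Local Notation q := #|F|.
Local Open Scope nat_scope.

Definition qfact a := \prod_(s < a) qint q s.+1.

Lemma qfactS a : qfact a.+1 = qfact a * qint q a.+1.
Proof. exact: big_ord_recr. Qed.

Lemma qfact_gt0 a : 0 < qfact a.
Proof. by apply: prodn_gt0 => s; apply: qint_gt0. Qed.

Lemma card_subspaces_fact n (W : Bq F n) b : b <= \dim W ->
  #|subspaces_in W b| * (qfact b * qfact (\dim W - b)) = qfact (\dim W).
Proof.
elim: b => [|b IHb] le_b.
  by rewrite card_subspaces0 /qfact big_ord0 subn0 !mul1n.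
rewrite -{}IHb ?(ltnW le_b) // -(subnSK le_b) !qfactS subnSK //.
transitivity (#|subspaces_in W b.+1| * qint q b.+1 * (qfact b * qfact (\dim W - b.+1))).
  ring.
rewrite -card_subspaces_rec; ring.
Qed.

Lemma qbinom_subspaces a b : qbinom F a%:Z b%:Z = #|subspaces_in (fullv : Bq F a) b|.
Proof. by apply: eq_card => Z; rewrite !inE subvf. Qed.

Lemma dim_full a : \dim (fullv : Bq F a) = a.
Proof. by rewrite dimvf dim_matrix -[RHS]muln1. Qed.

Lemma qbinom_fact a b : b <= a ->
  qbinom F a%:Z b%:Z * (qfact b * qfact (a - b)) = qfact a.
Proof.
move=> le_b; have := @card_subspaces_fact a fullv b.
by rewrite dim_full qbinom_subspaces; apply.
Qed.

Lemma qbinom_gt a b : a < b -> qbinom F a%:Z b%:Z = 0.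
Proof. by move=> lt_b; rewrite qbinom_subspaces card_subspaces_gt ?dim_full. Qed.

Lemma qbinom_gt0 a b : b <= a -> 0 < qbinom F a%:Z b%:Z.
Proof.
by move=> le_b; have := qfact_gt0 a; rewrite -(qbinom_fact le_b) muln_gt0 => /andP[].
Qed.

Lemma card_subspacesE n (W : Bq F n) b :
  #|subspaces_in W b| = qbinom F (\dim W)%:Z b%:Z.
Proof.
have [le_b | lt_b] := leqP b (\dim W); last by rewrite qbinom_gt // card_subspaces_gt.
apply/eqP; rewrite -(@eqn_pmul2r (qfact b * qfact (\dim W - b))).
  by rewrite qbinom_fact // card_subspaces_fact.
by rewrite muln_gt0 !qfact_gt0.
Qed.

End QBinomial.

(** * Identities between q-binomial coefficients *)

Section QIdentities.
Variable F : finFieldType.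
Local Notation q := #|F|.
Local Open Scope nat_scope.

Lemma qintD a b : qint q (a + b) = qint q a + q ^ a * qint q b.
Proof.
rewrite /qint big_split_ord /= big_distrr /=; congr (_ + _).
by apply: eq_bigr => s _; rewrite expnD.
Qed.

Lemma qbinom0 a : qbinom F a%:Z 0%:Z = 1.
Proof. by rewrite qbinom_subspaces card_subspaces0. Qed.

Lemma qbinomnn a : qbinom F a%:Z a%:Z = 1.
Proof.
apply/eqP; rewrite -(@eqn_pmul2r (qfact F a)) ?qfact_gt0 // mul1n.
by rewrite -{2}(qbinom_fact F (leqnn a)) subnn /qfact big_ord0 muln1.
Qed.

Lemma qbinom_step a b :
  qbinom F a%:Z b.+1%:Z * qint q b.+1 = qbinom F a%:Z b%:Z * qint q (a - b).
Proof. by rewrite !qbinom_subspaces -card_subspaces_rec dim_full. Qed.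

Lemma qbinomS a b :
  qbinom F a.+1%:Z b.+1%:Z = qbinom F a%:Z b%:Z + q ^ b.+1 * qbinom F a%:Z b.+1%:Z.
Proof.
have [lt_ab | le_ba] := ltnP a b; first by rewrite !qbinom_gt ?muln0 //; lia.
apply/eqP; rewrite -(@eqn_pmul2r (qfact F b.+1 * qfact F (a - b))); last first.
  by rewrite muln_gt0 !qfact_gt0.
have := qbinom_fact F (_ : b.+1 <= a.+1); rewrite subSS => -> //; apply/eqP.
rewrite !qfactS -(qbinom_fact F le_ba).
have -> : qint q a.+1 = qint q b.+1 + q ^ b.+1 * qint q (a - b).
  by rewrite -qintD addSn subnKC.
transitivity (qbinom F a b * (qfact F b * qfact F (a - b)) * qint q b.+1 +
   q ^ b.+1 * qfact F b * qfact F (a - b) * (qbinom F a b * qint q (a - b))).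
  ring.
rewrite -qbinom_step; ring.
Qed.

(** The q-analogue of choosing a subset of a subset in either order. *)
Lemma qbinom_trinomial w u t : t <= u -> u <= w ->
  qbinom F w%:Z u%:Z * qbinom F u%:Z t%:Z =
  qbinom F w%:Z t%:Z * qbinom F (w - t)%N%:Z (u - t)%N%:Z.
Proof.
move=> le_tu le_uw; apply/eqP.
rewrite -(@eqn_pmul2r (qfact F t * qfact F (u - t) * qfact F (w - u))); last first.
  by rewrite !muln_gt0 !qfact_gt0.
have e1 := qbinom_fact F le_uw; have e2 := qbinom_fact F le_tu.
have e3 := qbinom_fact F (leq_trans le_tu le_uw).
have e4 := qbinom_fact F (leq_sub2r t le_uw).
have e5 : w - t - (u - t) = w - u by lia.
rewrite e5 in e4; apply/eqP.
transitivity (qbinom F w u *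
    (qbinom F u t * (qfact F t * qfact F (u - t)) * qfact F (w - u))).
  ring.
rewrite e2 e1 -e3 -e4; ring.
Qed.

End QIdentities.

Section Moebius.
Variables (C : numFieldType) (F : finFieldType).
Local Notation q := #|F|.
Local Notation B a b := ((qbinom F a%:Z b%:Z)%:R : C).

(** The q-Pascal rule makes the alternating sum telescope, which gives all its
    partial sums in closed form. *)
Lemma alternating_qbinom_partial r m :
  \sum_(s < m.+1) (-1) ^+ s * q%:R ^+ 'C(s, 2) * B r.+1 s =
  (-1) ^+ m * q%:R ^+ 'C(m.+1, 2) * B r m.
Proof.
elim: m => [|m IHm]; first by rewrite big_ord1 !qbinom0 !mulr1.
rewrite big_ord_recr /= {}IHm qbinomS natrD natrM natrX [in RHS]binS bin1.
by rewrite [in RHS]exprD (exprS (-1)); ring.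
Qed.

Lemma alternating_qbinom r :
  \sum_(s < r.+1) (-1) ^+ s * q%:R ^+ 'C(s, 2) * B r s = (r == 0)%N%:R.
Proof.
case: r => [|r]; first by rewrite big_ord1 qbinom0 !mulr1.
by rewrite alternating_qbinom_partial qbinom_gt // mulr0.
Qed.

(** The matrix inverse to that of the q-binomial coefficients. *)
Definition moebius (t u : nat) : C :=
  (-1) ^+ (u - t) * q%:R ^+ 'C(u - t, 2) * B u t.

(** The trinomial identity factors [w choose t]_q out of the sum and leaves the
    alternating sum of the q-binomial coefficients of w - t, which vanishes
    unless w = t. *)
Lemma moebius_inversion n w t : (w <= n)%N ->
  \sum_(u < n.+1) moebius t u * B w u = (w == t)%:R.
Proof.
move=> le_wn; have [lt_wt | le_tw] := ltnP w t.
  rewrite big1 ?ltn_eqF // => u _; have [lt_ut | le_tu] := ltnP u t.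
    by rewrite /moebius (qbinom_gt _ lt_ut) mulr0 mul0r.
  by rewrite (@qbinom_gt _ w) ?mulr0 // (leq_trans lt_wt).
(* Only the terms with t <= u <= w are nonzero. *)
rewrite -(big_mkord predT (fun u => moebius t u * B w u)).
rewrite (big_cat_nat (leq0n t) (leq_trans le_tw (ltnW _))) ?ltnS //=.
rewrite big1_seq ?add0r; last first.
  move=> u; rewrite mem_index_iota => /andP[_ /andP[_ lt_ut]].
  by rewrite /moebius (qbinom_gt _ lt_ut) mulr0 mul0r.
rewrite (@big_cat_nat _ _ _ w.+1 t) ?ltnS //=; last exact: leqW.
rewrite [X in _ + X]big1_seq ?addr0; last first.
  move=> u; rewrite mem_index_iota => /andP[_ /andP[lt_wu _]].
  by rewrite qbinom_gt ?mulr0.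
rewrite -{1}[t]add0n big_addn subSn // big_mkord.
transitivity (B w t * \sum_(s < (w - t).+1) (-1) ^+ s * q%:R ^+ 'C(s, 2) * B (w - t)%N s).
  rewrite mulr_sumr; apply: eq_bigr => s _; rewrite /moebius addnK.
  have := @qbinom_trinomial F w (s + t) t (leq_addl _ _).
  rewrite addnK => /(_ _)/(congr1 (fun x => x%:R : C)).
  rewrite !natrM => e; transitivity ((-1) ^+ s * q%:R ^+ 'C(s, 2)
    * (B w (s + t)%N * B (s + t)%N t) : C); first ring.
  rewrite e; first ring.
  by have := ltn_ord s; lia.
rewrite alternating_qbinom subn_eq0; case: eqVneq => [-> | ne_wt].
  by rewrite leqnn mulr1 qbinomnn.
by rewrite leqNgt ltn_neqAle eq_sym ne_wt le_tw mulr0.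
Qed.

(** The trinomial identity with one coefficient expanded in factorials, in the
    form in which factorials appear in quotients of norms. *)
Lemma qfact_qbinom M a b : (b <= a)%N -> (a <= M)%N ->
  (qfact F a)%:R * B M a =
  (qfact F b)%:R * (qfact F (a - b))%:R * B M b * B (M - b)%N (a - b)%N.
Proof.
move=> le_ba le_aM; rewrite -mulrA -[B M b * _]natrM -qbinom_trinomial //.
rewrite -(qbinom_fact F le_ba) !natrM; ring.
Qed.

Lemma qbinom_sub_lt (m : int) b d : (b < d)%N -> qbinom F m (b%:Z - d%:Z) = 0%N.
Proof.
move=> lt_bd; have -> : b%:Z - d%:Z = - (d - b.+1).+1%:Z by lia.
by case: m.
Qed.

(** Relates [moebius] to the integer exponents in [beta]. When u < t both sides
    vanish with [u choose t], which makes the truncated subtractions harmless. *)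
Lemma moebius_int t u e : moebius t u * q%:R ^- e =
  (-1) ^ (u%:Z - t%:Z) * q%:R ^ ('C(u - t, 2)%:Z - e%:Z) * (qbinom F u t)%:R.
Proof.
have [lt_ut | le_tu] := ltnP u t.
  by rewrite /moebius (qbinom_gt _ lt_ut) !mulr0 mul0r.
have q0 : q%:R != 0 :> C by rewrite pnatr_eq0 -lt0n (ltnW (q_gt1 F)).
by rewrite subzn // /moebius expfzDr // -exprnN -!exprnP; ring.
Qed.

End Moebius.

(** * Matrices indexed by finite types *)

Section IndexedMatrices.
Variable C : numClosedFieldType.
Implicit Types I J K : finType.

Lemma entry_mx_of I J (f : I -> J -> C) x y : entry (mx_of f) x y = f x y.
Proof. by rewrite /entry mxE !enum_rankK. Qed.

Lemma entry_inj I J (M N : idxmx C I J) :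
  (forall x y, entry M x y = entry N x y) -> M = N.
Proof.
move=> eqMN; apply/matrixP=> a b.
by have := eqMN (enum_val a) (enum_val b); rewrite /entry !enum_valK.
Qed.

Lemma sum_enum_rank I (f : 'I_#|{: I}| -> C) : \sum_a f a = \sum_(x : I) f (enum_rank x).
Proof. by rewrite (reindex _ (onW_bij _ (@enum_rank_bij I))). Qed.

Lemma entry_mul I J K (M : idxmx C I J) (N : idxmx C J K) x z :
  entry (M *m N) x z = \sum_y entry M x y * entry N y z.
Proof. by rewrite /entry mxE sum_enum_rank. Qed.

Lemma entry_adj I J (M : idxmx C I J) x y : entry (adjmx M) y x = (entry M x y)^*.
Proof. by rewrite /entry !mxE. Qed.

Lemma entryZ I J (c : C) (M : idxmx C I J) x y : entry (c *: M) x y = c * entry M x y.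
Proof. by rewrite /entry mxE. Qed.

Lemma mul_entry_col I J (M : idxmx C I J) (v : 'cV[C]_#|{: J}|) x :
  (M *m v) (enum_rank x) 0 = \sum_y entry M x y * v (enum_rank y) 0.
Proof. by rewrite mxE sum_enum_rank. Qed.

Lemma adjmxM a b c (M : 'M[C]_(a, b)) (N : 'M[C]_(b, c)) :
  adjmx (M *m N) = adjmx N *m adjmx M.
Proof. by rewrite /adjmx trmx_mul map_mxM. Qed.

Lemma adjmxK a b (M : 'M[C]_(a, b)) : adjmx (adjmx M) = M.
Proof. by apply/matrixP=> x y; rewrite !mxE conjCK. Qed.

Lemma adjmxZ a b (c : C) (M : 'M[C]_(a, b)) : adjmx (c *: M) = c^* *: adjmx M.
Proof. by apply/matrixP=> x y; rewrite !mxE rmorphM. Qed.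

Lemma left_inverse_sq a b (M : 'M[C]_(a, b)) (N : 'M[C]_(b, a)) :
  a = b -> M *m N = 1%:M -> N *m M = 1%:M.
Proof. by move=> eq_ab; case: b / eq_ab in M N *; apply: mulmx1C. Qed.

End IndexedMatrices.

(** * Inclusion matrices *)

Section Inclusion.
Variables (C : numClosedFieldType) (F : finFieldType) (n : nat).
Local Notation q := #|F|.
Implicit Types X Y Z : Bq F n.

(** This is M^u_(i,u). Multiplication by it sums the coordinates of rank u over
    the subspaces of each i-dimensional space. *)
Definition incl (i u : nat) : idxmx C (Bq F n) (Bq F n) :=
  mx_of (fun X Y => [&& \dim X == i, \dim Y == u & (Y <= X)%VS]%:R).

Lemma Mt_moebius i j t : Mt_mx C F n i j t =
  \sum_(u < n.+1) moebius C F t u *: (incl i u *m adjmx (incl j u)).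
Proof.
apply: entry_inj => X Y; rewrite entry_mx_of /entry summxE.
transitivity (\sum_(u < n.+1) moebius C F t u *
    ((\dim X == i) && (\dim Y == j))%:R * (qbinom F (\dim (X :&: Y)) u)%:R).
  transitivity (((\dim X == i) && (\dim Y == j))%:R * (\dim (X :&: Y) == t)%:R : C).
    by rewrite -natrM mulnb -andbA.
  rewrite -(@moebius_inversion C F n).
    by rewrite mulr_sumr; apply: eq_bigr => u _; rewrite mulrCA mulrA.
  by rewrite -[leqRHS](dim_full F) dimvS ?subvf.
apply: eq_bigr => u _; rewrite [RHS]mxE -mulrA; congr (_ * _).
rewrite -[RHS]/(entry _ X Y) entry_mul -card_subspacesE -natrM mulnC.
rewrite -sum_nat_const natr_sum big_mkcond; apply: eq_bigr => Z _.
rewrite entry_adj !entry_mx_of conjC_nat inE subv_cap -natrM mulnb.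
case: (\dim X == i); rewrite ?andbF ?if_same //=.
case: (\dim Y == j); rewrite ?andbF ?if_same //=.
by case: (\dim Z == u); case: (_ <= X)%VS; case: (_ <= Y)%VS.
Qed.

(** The (X, Y) entry of the product counts the hyperplanes of X that contain
    Y. *)
Lemma upmx_incl i u : (u <= i)%N ->
  upmx C F n *m incl i u = (qint q (i.+1 - u))%:R *: incl i.+1 u.
Proof.
move=> le_ui; apply: entry_inj => X Y; rewrite entry_mul entryZ.
under eq_bigr do rewrite !entry_mx_of -natrM mulnb.
rewrite entry_mx_of -natr_sum -natrM; congr _%:R.
case: and3P => [[/eqP dimX /eqP dimY leYX] | not_inc]; last first.
  rewrite muln0 big1 // => Z _.
  case: and4P => // [[/andP[leZX /eqP dimX] /eqP dimZ dimY leYZ]].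
  case: not_inc; split=> //; last exact: subv_trans leZX.
  by rewrite dimX dimZ.
rewrite muln1 -dimX -dimY -card_cocovers // -sum1dep_card [RHS]big_mkcond.
apply: eq_bigr => Z _; rewrite dimX dimY eqxx !eqSS /= [i == _]eq_sym.
by case: (Z <= X)%VS; case: (Y <= Z)%VS; case: (\dim Z == i).
Qed.

Lemma incl_id u (v : VB C F n) : homogeneous u v -> incl u u *m v = v.
Proof.
move=> hom_v; apply/matrixP=> a b; rewrite ord1 {b} -[a]enum_valK.
move: (enum_val a) => {a} X; rewrite mul_entry_col.
have [dimX | ne_dim] := eqVneq (\dim X) u; last first.
  rewrite hom_v // big1 // => Y _; rewrite entry_mx_of.
  by rewrite (negPf ne_dim) mul0r.
rewrite (bigD1 X) //= entry_mx_of dimX eqxx subvv mul1r.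
rewrite big1 ?addr0 // => Y neYX; rewrite entry_mx_of.
case: and3P => [[_ /eqP dimY leYX] | _]; last by rewrite mul0r.
by case/eqP: neYX; apply/eqP; rewrite eqEdim leYX dimX dimY leqnn.
Qed.

Lemma incl_homogeneous_neq i u r (v : VB C F n) : homogeneous r v -> r != u ->
  incl i u *m v = 0.
Proof.
move=> hom_v ne_ru; apply/matrixP=> a b; rewrite ord1 {b} -[a]enum_valK.
move: (enum_val a) => {a} X; 
rewrite mul_entry_col mxE big1 // => Y _; rewrite entry_mx_of.
have [dimY | ne_dim] := eqVneq (\dim Y) r; last by rewrite hom_v // mulr0.
by rewrite dimY (negPf ne_ru) andbF mul0r.
Qed.

Lemma incl_lt i u : (i < u)%N -> incl i u = 0.
Proof.
move=> lt_iu; apply: entry_inj => X Y; rewrite entry_mx_of /entry mxE.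
by case: and3P => // [[/eqP dimX /eqP dimY /dimvS]]; lia.
Qed.

(** By [upmx_incl], [incl i u] acts on rank u as U^(i-u) / [i-u]_q!. The
    conditional covers the ranks past the end of the chain, where U has
    already produced 0. *)
Lemma incl_chain k (v : nat -> VB C F n) u i :
  symmetric_Jordan_chain k v -> (k <= u <= n - k)%N -> (u <= i)%N ->
  incl i u *m v u = (qfact F (i - u))%:R^-1 *: (if (i <= n - k)%N then v i else 0).
Proof.
case=> _ v_hom v_up v_top /andP[le_ku le_un] le_ui.
rewrite -(subnKC le_ui); move: (i - u)%N => d {i le_ui}; rewrite addKn.
elim: d => [|d IHd].
  rewrite addn0 le_un /qfact big_ord0 invr1 scale1r incl_id //.
  by case: (v_hom u) => //; rewrite le_ku.
have q0 : (qint q d.+1)%:R != 0 :> C by rewrite pnatr_eq0 -lt0n qint_gt0.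
have := upmx_incl (leq_addr d u); rewrite -addnS addKn.
move/(congr1 (fun M => (qint q d.+1)%:R^-1 *: (M *m v u))).
rewrite -scalemxAl scalerA mulVf // scale1r => <-.
rewrite -mulmxA IHd -scalemxAr scalerA qfactS natrM invfM mulrC.
congr (_ *: _); case: leqP => [le_n | lt_n]; last first.
  by rewrite mulmx0 ifN // -ltnNge addnS ltnW.
case: leqP => [le_n1 | lt_n1]; last by rewrite (_ : (u + d = n - k)%N) //; lia.
by rewrite -(v_up (u + d.+1)%N) ?addnS //; lia.
Qed.

End Inclusion.

(** * The orthonormal basis of a family of Jordan chains *)

Section HermitianForm.
Variables (C : numClosedFieldType) (F : finFieldType) (n : nat).
Implicit Types v w : VB C F n.

Lemma cvdotE v w : cvdot v w = \sum_a (v a 0)^* * w a 0.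
Proof. by rewrite /cvdot mxE; apply: eq_bigr => a _; rewrite !mxE. Qed.

Lemma cvdotZl a v w : cvdot (a *: v) w = a^* * cvdot v w.
Proof. by rewrite /cvdot adjmxZ -scalemxAl mxE. Qed.

Lemma cvdotZr a v w : cvdot v (a *: w) = a * cvdot v w.
Proof. by rewrite /cvdot -scalemxAr mxE. Qed.

Lemma cvdot0r v : cvdot v 0 = 0.
Proof. by rewrite /cvdot mulmx0 mxE. Qed.

Lemma cvdot_ge0 v : 0 <= cvdot v v.
Proof. by rewrite cvdotE sumr_ge0 // => a _; rewrite mulrC mul_conjC_ge0. Qed.

Lemma cvdot_eq0 v : (cvdot v v == 0) = (v == 0).
Proof.
apply/eqP/eqP=> [|->]; last exact: cvdot0r.
rewrite cvdotE => /eqP; rewrite psumr_eq0 => [/allP v0|a _]; last first.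
  by rewrite mulrC mul_conjC_ge0.
apply/matrixP=> a b; rewrite ord1 mxE; apply/eqP.
by have := v0 a (mem_index_enum _); rewrite mulrC mul_conjC_eq0.
Qed.

Lemma cvnorm_ge0 v : 0 <= cvnorm v.
Proof. by rewrite sqrtC_ge0 cvdot_ge0. Qed.

Lemma cvnorm_gt0 v : v != 0 -> 0 < cvnorm v.
Proof. by rewrite -cvdot_eq0 lt_def cvnorm_ge0 sqrtC_eq0 => ->. Qed.

Lemma cvdot_cvnorm v : cvdot v v = cvnorm v ^+ 2.
Proof. by rewrite sqrtCK. Qed.

End HermitianForm.

Section JordanBasis.
Variables (C : numClosedFieldType) (F : finFieldType) (n : nat).
Variable J : chain_family C F n.
Implicit Types x y z : jindex J.
Local Notation q := #|F|.
Local Notation N := (Nmx J).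

Definition jrank x := (tag x + (tagged x).2)%N.
Definition jnorm x := cvnorm (jvec x).

Lemma jrank_jidx k (c : chain J k) a : jrank (jidx c a) = (k + a)%N.
Proof. by []. Qed.

Lemma jchain_jidx k (c d : chain J k) a b :
  (jchain (jidx c a) == jchain (jidx d b)) = (c == d).
Proof. exact: eq_Tagged. Qed.

Lemma jindexP x y : jchain x = jchain y -> jrank x = jrank y -> x = y.
Proof.
case: x => k [c a]; case: y => l [d b]; rewrite /jchain /jrank /= => eq_ch.
have eq_kl : k = l := congr1 tag eq_ch; subst l.
move/eqP: eq_ch; rewrite eq_Tagged /= => /eqP <- /addnI eq_ab.
by rewrite (val_inj eq_ab).
Qed.

Hypothesis J_basis : symmetric_Jordan_basis J.

Lemma jrank_bounds x : (tag x <= jrank x <= n - tag x)%N.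
Proof.
case: x => k [c a]; have [le_kn _ _ _] := J_basis.1 k c.
by rewrite /jrank /=; have := ltn_ord a; rewrite /blocksize; lia.
Qed.

Lemma jvec_neq0 x : jvec x != 0.
Proof.
have := jrank_bounds x; case: x => k [c a] bnd.
by have [_ v_hom _ _] := J_basis.1 k c; have [] := v_hom _ bnd.
Qed.

Lemma jvec_homogeneous x : homogeneous (jrank x) (jvec x).
Proof.
have := jrank_bounds x; case: x => k [c a] bnd.
by have [_ v_hom _ _] := J_basis.1 k c; have [] := v_hom _ bnd.
Qed.

Lemma jnorm_gt0 x : 0 < jnorm x.
Proof. exact/cvnorm_gt0/jvec_neq0. Qed.

(** This makes [Nmx] square up to a cast, so that an isometry is unitary. *)
Lemma card_jindex : #|{: jindex J}| = #|{: Bq F n}|.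
Proof.
have := @size_basis _ _ fullv _ (in_tuple [seq jvec x | x : jindex J]).
rewrite dimvf dim_matrix mulr1 => /(_ J_basis.2) ->.
by rewrite size_map -cardE.
Qed.

Lemma incl_jvec i x : (jrank x <= i)%N ->
  incl C F n i (jrank x) *m jvec x = (qfact F (i - jrank x))%:R^-1 *:
    (if (i <= n - tag x)%N then cvec (tagged x).1 i else 0).
Proof.
by move=> le_xi; rewrite -incl_chain //; [exact: J_basis.1 | exact: jrank_bounds].
Qed.

(** Conjugation by N computes sesquilinear products of normalized basis
    vectors. *)
Lemma entry_conjugated (M : idxmx C (Bq F n) (Bq F n)) x y :
  entry (adjmx N *m M *m N) x y =
  (jnorm x)^-1 * (jnorm y)^-1 * cvdot (jvec x) (M *m jvec y).
Proof.
have colN z : col (enum_rank z) N = (jnorm z)^-1 *: jvec z.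
  apply/matrixP=> a b; rewrite ord1 -[a]enum_valK !mxE !enum_rankK //.
have -> : entry (adjmx N *m M *m N) x y =
    cvdot (col (enum_rank x) N) (M *m col (enum_rank y) N).
  have -> : M *m col (enum_rank y) N = col (enum_rank y) (M *m N).
    by rewrite !colE mulmxA.
  rewrite -mulmxA cvdotE /entry [LHS]mxE.
  by apply: eq_bigr => a _; rewrite !mxE.
rewrite !colN -scalemxAr cvdotZl cvdotZr mulrA.
by rewrite geC0_conj ?invr_ge0 ?cvnorm_ge0.
Qed.

Hypothesis J_orthogonal : orthogonal_basis J.

Lemma cvdot_jvec x y : cvdot (jvec x) (jvec y) = (x == y)%:R * jnorm x ^+ 2.
Proof.
have [<- | ne_xy] := eqVneq; first by rewrite mul1r -cvdot_cvnorm.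
by rewrite J_orthogonal // mul0r.
Qed.

Lemma Nmx_isometry : adjmx N *m N = 1%:M.
Proof.
apply: entry_inj => x y; have := entry_conjugated 1%:M x y.
rewrite mulmx1 mul1mx => ->; rewrite cvdot_jvec /entry mxE (inj_eq enum_rank_inj).
have [<- | _] := eqVneq x y; last by rewrite !mul0r mulr0.
have nz_x : jnorm x != 0 by rewrite gt_eqF ?jnorm_gt0.
by rewrite mul1r -invfM -expr2 mulVf // expf_neq0.
Qed.

Lemma Nmx_unitary : N *m adjmx N = 1%:M.
Proof. exact: left_inverse_sq card_jindex Nmx_isometry. Qed.

(** The entry of [incl i u] in the normalized Jordan basis, see [entry_incl]. *)
Definition incl_coef i u x z : C :=
  [&& jchain x == jchain z, jrank x == i, jrank z == u & (u <= i)%N]%:R *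
     (jnorm x / (jnorm z * (qfact F (i - u))%:R)).

Lemma incl_coef_conj i u x z : (incl_coef i u x z)^* = incl_coef i u x z.
Proof.
apply: geC0_conj; rewrite mulr_ge0 ?ler0n // divr_ge0 ?cvnorm_ge0 //.
by rewrite mulr_ge0 ?cvnorm_ge0.
Qed.

Lemma entry_incl i u x z :
  entry (adjmx N *m incl C F n i u *m N) x z = incl_coef i u x z.
Proof.
rewrite entry_conjugated /incl_coef.
have [rank_z | ne_zu] := eqVneq (jrank z) u; last first.
  rewrite (incl_homogeneous_neq _ (@jvec_homogeneous z) ne_zu) cvdot0r mulr0.
  by rewrite !andbF mul0r.
have [le_ui | lt_iu] := leqP u i; last first.
  by rewrite incl_lt // mul0mx cvdot0r mulr0 !andbF mul0r.
rewrite -rank_z incl_jvec ?rank_z // cvdotZr.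
have nz_z : jnorm z != 0 by rewrite gt_eqF ?jnorm_gt0.
have nz_x : jnorm x != 0 by rewrite gt_eqF ?jnorm_gt0.
have nz_q : (qfact F (i - u))%:R != 0 :> C by rewrite pnatr_eq0 -lt0n qfact_gt0.
have bnd_z := jrank_bounds z; have bnd_x := jrank_bounds x.
case: (leqP i (n - tag z)) => [le_i | lt_i]; last first.
  rewrite cvdot0r !mulr0.
  case: and4P => [[/eqP eq_ch /eqP rank_x _ _] | _]; last by rewrite mul0r.
  by have : tag x = tag z :> nat := congr1 (fun p => nat_of_ord (tag p)) eq_ch; lia.
have lt_i : (i - tag z < blocksize n (tag z))%N.
  by move: (nat_of_ord (tag z)) bnd_z le_i => k; rewrite /blocksize; lia.
pose z' := jidx (tagged z).1 (Ordinal lt_i).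
have rank_z' : jrank z' = i by rewrite jrank_jidx /=; lia.
have -> : cvec (tagged z).1 i = jvec z' by rewrite -rank_z'.
have ch_z' : jchain z' = jchain z by [].
rewrite cvdot_jvec !andbT; have -> : (x == z') = (jchain x == jchain z) && (jrank x == i).
  apply/eqP/andP => [-> | [/eqP eq_ch /eqP rank_x]]; first by rewrite ch_z' rank_z' !eqxx.
  by apply: jindexP; rewrite ?ch_z' ?rank_z'.
by case: (_ && _); rewrite ?mul0r ?mulr0 //; field; apply/and3P.
Qed.

(** * Number of chains starting at each rank *)

(** Both sides are traces of the projection [incl r r] onto rank r, taken in the
    Jordan basis and in the standard basis. *)
Lemma card_jrank r : #|[set x : jindex J | jrank x == r]| = qbinom F n%:Z r%:Z.
Proof.
apply/eqP; rewrite -(eqr_nat C) qbinom_subspaces -!sum1dep_card !natr_sum.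
have trE (I : finType) (M : idxmx C I I) : \tr M = \sum_x entry M x x.
  by rewrite /mxtrace sum_enum_rank.
have := mxtrace_mulC (adjmx N *m incl C F n r r) N.
rewrite [in RHS]mulmxA Nmx_unitary // mul1mx !trE => tr_eq.
apply/eqP; transitivity (\sum_x entry (adjmx N *m incl C F n r r *m N) x x).
  rewrite big_mkcond; apply: eq_bigr => x _; rewrite entry_incl // /incl_coef.
  have nz_x : jnorm x != 0 by rewrite gt_eqF ?jnorm_gt0.
  rewrite eqxx leqnn subnn /qfact big_ord0 mulr1 divff // mulr1 andbT andbb.
  by case: (_ == r).
rewrite tr_eq [RHS]big_mkcond; apply: eq_bigr => X _.
by rewrite entry_mx_of subvf subvv andbT andbb; case: (_ == r).
Qed.

(** A chain meets each rank at most once, so it may be counted instead of its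
    vector of rank r. *)
Lemma card_jrank_chain r :
  #|[set jchain x | x in [set x : jindex J | jrank x == r]]| = qbinom F n%:Z r%:Z.
Proof.
rewrite -card_jrank card_in_imset // => x y; rewrite !inE => /eqP rx /eqP ry eq_ch.
by apply: jindexP => //; rewrite rx ry.
Qed.

(** Otherwise, for k > 0, every chain through rank k also passes through rank
    k - 1, so that [n choose k]_q <= [n choose k-1]_q. This contradicts
    [n choose k]_q [k] = [n choose k-1]_q [n-k+1], as k < n - k + 1. *)
Lemma chain_exists (k : 'I_n./2.+1) : inhabited (chain J k).
Proof.
apply: contrapT => no_chain.
have le_kn : (k.*2 <= n)%N by have := ltn_ord k; lia.
have chain_k x : jrank x = k -> (0 < (tagged x).2)%N.
  case: x => l [c a]; rewrite /jrank /=; case: posnP => // ->; rewrite addn0.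
  move/val_inj=> eq_lk; subst l; by case: no_chain; exact: (inhabits c).
case def_k : (k : nat) => [|r].
  (* The zero subspace forces a basis vector of rank 0, hence a chain. *)
  have := card_jrank 0; rewrite qbinom0 => /eqP/cards1P[x /setP/(_ x)].
  rewrite !inE eqxx => /eqP rank_x.
  have := @chain_k x; rewrite rank_x def_k => /(_ erefl).
  by move: rank_x; rewrite /jrank; lia.
have le_card : (qbinom F n%:Z r.+1%:Z <= qbinom F n%:Z r%:Z)%N.
  rewrite -!card_jrank_chain; apply/subset_leq_card/subsetP=> ch /imsetP[x].
  rewrite inE => /eqP rank_x ->; have := chain_k x; rewrite rank_x def_k => /(_ erefl).
  move=> x_gt0; have lt_a : ((tagged x).2.-1 < blocksize n (tag x))%N.
    exact: leq_ltn_trans (leq_pred _) (ltn_ord _).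
  apply/imsetP; exists (jidx (tagged x).1 (Ordinal lt_a)) => //.
  by rewrite inE jrank_jidx /=; move: rank_x; rewrite /jrank; lia.
have := qbinom_step F n r.
have -> : (n - r = r.+1 + (n - r - r.+1))%N by lia.
rewrite qintD => /eqP; apply/negP; rewrite neq_ltn; apply/orP; left.
rewrite mulnDr -[X in (X < _)%N]addn0 -addnS leq_add ?leq_mul //.
have -> : (n - r - r.+1 = (n - r - r.+1).-1.+1)%N by lia.
by rewrite !muln_gt0 qbinom_gt0 ?expn_gt0 ?qint_gt0 ?(ltnW (q_gt1 F)) //; lia.
Qed.

(** * Norms along a chain *)

Hypothesis J_ratios : norm_ratios J.
Local Notation B a b := ((qbinom F a%:Z b%:Z)%:R : C).
Local Notation s := (sqrtC (q%:R : C)).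

Lemma sqrtC_qbinom_step a b :
  sqrtC (B a b.+1) * sqrtC (qint q b.+1)%:R = sqrtC (B a b) * sqrtC (qint q (a - b))%:R.
Proof. by rewrite -!sqrtCM ?nnegrE ?ler0n // -!natrM qbinom_step. Qed.

Lemma cvec_neq0 (k : 'I_n./2.+1) (c : chain J k) u :
  (k <= u <= n - k)%N -> cvec c u != 0.
Proof. by have [_ v_hom _ _] := J_basis.1 k c; case/v_hom. Qed.

(** The square of the product of the prescribed norm ratios is q^(ka) times
    [1]...[a] [n-2k]...[n-2k-a+1], that is q^(ka) ([a]!)^2 [n-2k choose a]. *)
Lemma chain_norm (k : 'I_n./2.+1) (c : chain J k) a : (a <= n - k.*2)%N ->
  cvnorm (cvec c (k + a)%N) = cvnorm (cvec c k) * s ^+ (k * a) * (qfact F a)%:R *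
    sqrtC (B (n - k.*2)%N a).
Proof.
elim: a => [|a IHa] le_a.
  by rewrite addn0 muln0 qbinom0 sqrtC1 /qfact big_ord0 !mulr1.
have le_kn : (k.*2 <= n)%N by have := ltn_ord k; lia.
have bnd : (k <= k + a < n - k)%N by lia.
have := J_ratios c bnd; move/(congr1 (fun r => r * cvnorm (cvec c (k + a)%N))).
have nz_v : cvnorm (cvec c (k + a)%N) != 0.
  by rewrite gt_eqF // cvnorm_gt0 // cvec_neq0 //; lia.
rewrite mulfVK // addnS => ->; rewrite IHa ?(ltnW le_a) //.
have -> : ((k + a).+1 - k = a.+1)%N by lia.
have -> : (n - k - (k + a) = n - k.*2 - a)%N by lia.
rewrite !natrM !sqrtCM ?nnegrE ?mulr_ge0 ?ler0n // natrX rootCX ?ler0n //.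
rewrite qfactS natrM mulnS exprD.
have := sqrtC_qbinom_step (n - k.*2) a.
set x := sqrtC (B _ a.+1); set y := sqrtC (B _ a); set r := sqrtC (qint q a.+1)%:R.
have -> : (qint q a.+1)%:R = r ^+ 2 by rewrite sqrtCK.
set w := sqrtC (qint q (_ - a))%:R => e.
transitivity (cvnorm (cvec c k) * s ^+ k * s ^+ (k * a) * (qfact F a)%:R * r * (y * w)).
  ring.
rewrite -e; ring.
Qed.

(** Up to powers of q, the left side is [i-k]! sqrt(B_i) / ([u-k]! [i-u]!
    sqrt(B_u)), where B_a is [n-2k choose a-k]; [qfact_qbinom] moves the
    factorials into a q-binomial coefficient and inverts the ratio of roots. *)
Lemma norm_quotient (k : 'I_n./2.+1) (c : chain J k) u i :
  (k <= u)%N -> (u <= i)%N -> (i <= n - k)%N ->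
  cvnorm (cvec c i) / (cvnorm (cvec c u) * (qfact F (i - u))%:R) =
  s ^+ (k * i) / s ^+ (k * u) * sqrtC (B (n - k.*2)%N (u - k)%N) /
    sqrtC (B (n - k.*2)%N (i - k)%N) * B (n - k - u)%N (i - u)%N.
Proof.
move=> le_ku le_ui le_in; have le_kn : (k.*2 <= n)%N by have := ltn_ord k; lia.
pose a := (i - k)%N; pose b := (u - k)%N.
have -> : i = (k + a)%N by rewrite /a; lia.
have -> : u = (k + b)%N by rewrite /b; lia.
have le_ba : (b <= a)%N by rewrite /a /b; lia.
have le_a : (a <= n - k.*2)%N by rewrite /a; lia.
rewrite !addKn subnDl !chain_norm //; last exact: leq_trans le_a.
have -> : (n - k - (k + b) = n - k.*2 - b)%N by lia.
have := qfact_qbinom C F le_ba le_a.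
have nzB M d : (d <= M)%N -> sqrtC (B M d) != 0.
  by move=> le_d; rewrite sqrtC_eq0 pnatr_eq0 -lt0n qbinom_gt0.
have nzf d : (qfact F d)%:R != 0 :> C by rewrite pnatr_eq0 -lt0n qfact_gt0.
have nzs d : s ^+ d != 0.
  by rewrite expf_neq0 // sqrtC_eq0 pnatr_eq0 -lt0n (ltnW (q_gt1 F)).
have nz_v : cvnorm (cvec c k) != 0.
  by rewrite gt_eqF // cvnorm_gt0 // cvec_neq0 //; lia.
have := nzB _ _ le_a; have := nzB _ _ (leq_trans le_ba le_a).
rewrite !mulnDr !exprD.
set x := sqrtC (B _ a); set y := sqrtC (B _ b); set z := B _ (a - b)%N => nzy nzx e.
have Ba : B (n - k.*2)%N a = x ^+ 2 by rewrite sqrtCK.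
have Bb : B (n - k.*2)%N b = y ^+ 2 by rewrite sqrtCK.
rewrite {}Ba {}Bb in e.
have -> : (qfact F a)%:R = (qfact F b)%:R * (qfact F (a - b))%:R * y ^+ 2 * z / x ^+ 2.
  by rewrite -e mulfK // expf_neq0.
by field; rewrite nzx nzy nz_v !nzs !nzf.
Qed.


(** * The diagonal blocks *)

(** Inserting N N^* = 1 between the two inclusion matrices makes each term of
    [Mt_moebius] a product of matrices known from [entry_incl]. *)
Lemma entry_Mt i j t x y : entry (adjmx N *m Mt_mx C F n i j t *m N) x y =
  \sum_(u < n.+1) moebius C F t u * \sum_z incl_coef i u x z * incl_coef j u y z.
Proof.
rewrite Mt_moebius mulmx_sumr mulmx_suml /entry summxE; apply: eq_bigr => u _.
rewrite -scalemxAr -scalemxAl -/(entry _ x y) entryZ; congr (_ * _).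
have -> : adjmx N *m (incl C F n i u *m adjmx (incl C F n j u)) *m N =
    (adjmx N *m incl C F n i u *m N) *m adjmx (adjmx N *m incl C F n j u *m N).
  rewrite !adjmxM adjmxK !mulmxA -[adjmx N *m _ *m N *m _]mulmxA.
  by rewrite Nmx_unitary // mulmx1.
rewrite entry_mul; apply: eq_bigr => z _.
by rewrite entry_adj !entry_incl // incl_coef_conj.
Qed.

(** Only the vector of rank u in the chain c contributes, if there is one. *)
Lemma sum_incl_coef i j u (k : 'I_n./2.+1) (c : chain J k) (a b : 'I_(blocksize n k)) :
  \sum_z incl_coef i u (jidx c a) z * incl_coef j u (jidx c b) z =
  [&& k <= u, u <= i, u <= j, k + a == i & k + b == j]%N%:R *
    (cvnorm (cvec c i) / (cvnorm (cvec c u) * (qfact F (i - u))%:R)) *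
    (cvnorm (cvec c j) / (cvnorm (cvec c u) * (qfact F (j - u))%:R)).
Proof.
have [bnd | not_bnd] := boolP (k <= u <= n - k)%N; last first.
  rewrite big1 => [|z _].
    case: and5P => [[le_ku le_ui _ /eqP def_i _] | _]; last by rewrite !mul0r.
    have := jrank_bounds (jidx c a); rewrite jrank_jidx /= => bnd.
    by case/negP: not_bnd; lia.
  rewrite /incl_coef.
  case: and4P => [[/eqP eq_ch _ /eqP rank_z _] | _]; last by rewrite !mul0r.
  have eq_tag : k = tag z :> nat := congr1 (fun p => nat_of_ord (tag p)) eq_ch.
  by case/negP: not_bnd; rewrite eq_tag -rank_z jrank_bounds.
have lt_u : (u - k < blocksize n k)%N by rewrite /blocksize; lia.
have rank_u : jrank (jidx c (Ordinal lt_u)) = u by rewrite jrank_jidx /=; lia.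
rewrite (bigD1 (jidx c (Ordinal lt_u))) //= big1 ?addr0 => [|z ne_z].
  rewrite /incl_coef !jchain_jidx !eqxx rank_u !jrank_jidx eqxx /=.
  have [le_ku _] := andP bnd; rewrite le_ku /jnorm /jvec /= subnKC //.
  case: (u <= i)%N; case: (u <= j)%N; rewrite ?andbF ?mul0r ?mulr0 //= !andbT.
  case: eqP => [-> | _]; case: eqP => [-> | _]; rewrite ?mul0r ?mulr0 ?mul1r //.
rewrite /incl_coef.
case: and4P => [[/eqP eq_ch _ /eqP rank_z _] | _]; last by rewrite !mul0r.
by case/eqP: ne_z; apply: jindexP; rewrite ?rank_u // -eq_ch.
Qed.

(** Term by term comparison of the sum over u with [beta]. The range of u that
    survives on the left is k <= u <= min(i, j); outside of it one of the
    q-binomial coefficients in [beta] has a negative lower argument. *)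
Lemma entry_Mt_diag i j t (k : 'I_n./2.+1) (c : chain J k) (a b : 'I_(blocksize n k)) :
  entry (adjmx N *m Mt_mx C F n i j t *m N) (jidx c a) (jidx c b) =
  s ^+ (k * (i + j))
   * (sqrtC (qbinom F (n%:Z - (k.*2)%:Z) (i%:Z - k%:Z))%:R)^-1
   * (sqrtC (qbinom F (n%:Z - (k.*2)%:Z) (j%:Z - k%:Z))%:R)^-1
   * beta C F n t i j k * ((k + a == i) && (k + b == j))%N%:R.
Proof.
rewrite entry_Mt; under eq_bigr do rewrite sum_incl_coef.
case: andP => [[/eqP def_i /eqP def_j] | _]; last first.
  by rewrite mulr0 big1 // => u _; rewrite !andbF !mul0r mulr0.
have le_kn : (k.*2 <= n)%N by have := ltn_ord k; lia.
have lt_a : (a < (n - k.*2).+1)%N := ltn_ord a.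
have lt_b : (b < (n - k.*2).+1)%N := ltn_ord b.
have le_in : (i <= n - k)%N by lia.
have le_jn : (j <= n - k)%N by lia.
rewrite mulr1 /beta mulr_sumr !subzn ?leq_addr //; try lia.
apply: eq_bigr => u _; rewrite !andbT.
have [le_ku | lt_uk] := leqP k u; last by rewrite qbinom_sub_lt // !(mul0r, mulr0).
have [le_ui | lt_iu] := leqP u i; last first.
  by rewrite [qbinom F _ (i%:Z - u%:Z)]qbinom_sub_lt // !(mul0r, mulr0).
have [le_uj | lt_ju] := leqP u j; last first.
  by rewrite [qbinom F _ (j%:Z - u%:Z)]qbinom_sub_lt // !(mul0r, mulr0).
have le_un := leq_trans le_ui le_in.
rewrite mul1r !norm_quotient // -moebius_int mulnDr exprD.
have le_nk : (k <= n)%N by apply: leq_trans le_kn; rewrite -addnn leq_addr.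
rewrite !subzn //.
have -> : q%:R ^- (k * u) = (s ^+ (k * u)) ^- 2 :> C by rewrite exprAC sqrtCK.
have nzB M d : (d <= M)%N -> sqrtC (B M d) != 0.
  by move=> le_d; rewrite sqrtC_eq0 pnatr_eq0 -lt0n qbinom_gt0.
set r := sqrtC (B _ (u - k)%N).
have -> : B (n - k.*2)%N (u - k)%N = r ^+ 2 by rewrite sqrtCK.
have nzs : s ^+ (k * u) != 0.
  by rewrite expf_neq0 // sqrtC_eq0 pnatr_eq0 -lt0n (ltnW (q_gt1 F)).
by field; rewrite nzs !nzB //; lia.
Qed.

End JordanBasis.

Theorem theorem4p1 (R : realType) (F : finFieldType) (n : nat)
    (J : chain_family R[i] F n)
    (J_basis : symmetric_Jordan_basis J)
    (J_orthogonal : orthogonal_basis J)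
    (J_ratios : norm_ratios J)
    (i j t : 'I_n.+1) (k : 'I_n./2.+1) :
  Phi J (Mt R[i] F n i j t) k =
  if (k <= i <= n - k)%N && (k <= j <= n - k)%N then
    (sqrtC #|F|%:R ^+ (k * (i + j))
     * (sqrtC (qbinom F (n%:Z - (k.*2)%:Z) (i%:Z - k%:Z))%:R)^-1
     * (sqrtC (qbinom F (n%:Z - (k.*2)%:Z) (j%:Z - k%:Z))%:R)^-1
     * beta R[i] F n t i j k) *: Emx R[i] n i j k
  else 0.
Proof.
pose coef (l : 'I_n./2.+1) : R[i] := sqrtC #|F|%:R ^+ (l * (i + j))
     * (sqrtC (qbinom F (n%:Z - (l.*2)%:Z) (i%:Z - l%:Z))%:R)^-1
     * (sqrtC (qbinom F (n%:Z - (l.*2)%:Z) (j%:Z - l%:Z))%:R)^-1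
     * beta R[i] F n t i j l.
have blocks : has_blocks (adjmx (Nmx J) *m sval (Mt R[i] F n i j t) *m Nmx J)
    [ffun l => coef l *: Emx R[i] n i j l].
  split=> [x y ne_xy | l c a b].
    rewrite entry_Mt // big1 // => u _; rewrite big1 ?mulr0 // => z _.
    rewrite /incl_coef.
    case: and4P => [[/eqP eq_x _ _ _] | _]; last by rewrite !mul0r.
    case: and4P => [[/eqP eq_y _ _ _] | _]; last by rewrite !(mul0r, mulr0).
    by case/eqP: ne_xy; rewrite eq_x eq_y.
  by rewrite entry_Mt_diag // ffunE !mxE.
have [_ block_k] : has_blocks (adjmx (Nmx J) *m sval (Mt R[i] F n i j t) *m Nmx J)
    (Phi J (Mt R[i] F n i j t)).
  by apply: classical_sets.xgetPex; exists [ffun l => coef l *: Emx R[i] n i j l].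
(* A chain at rank k makes the k-th block of any such family explicit. *)
have [c] := chain_exists J_basis J_orthogonal k.
have -> : Phi J (Mt R[i] F n i j t) k = coef k *: Emx R[i] n i j k.
  by apply/matrixP=> a b; rewrite -(block_k k c) blocks.2 ffunE.
(* Outside the range of ranks of the block, the matrix unit is already 0. *)
case: ifP => // /negbT not_range; apply/matrixP=> a b; rewrite !mxE.
case: andP => [[/eqP def_i /eqP def_j] | _]; last by rewrite mulr0.
have le_kn : (k.*2 <= n)%N by have := ltn_ord k; lia.
have lt_a : (a < (n - k.*2).+1)%N := ltn_ord a.
have lt_b : (b < (n - k.*2).+1)%N := ltn_ord b.
by case/negP: not_range; rewrite -def_i -def_j !leq_addr /=; lia.
Qed.
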